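(* Let $A\in\mathbb{R}^{n\times n}$ and let $A U = U B + u\, b^T$ be a Krylov decomposition of order $k$, with $U\in\mathbb{R}^{n\times k}$, $B\in\mathbb{R}^{k\times k}$, $u\in\mathbb{R}^n$, $b\in\mathbb{R}^k$. Then it is equivalent to a randomized Arnoldi decomposition, in the sense that both decompositions span the same space, for which $\Omega\in\mathbb{R}^{d\times n}$ is an $\epsilon$-embedding. That is, there exist a sketch-orthonormal $V\in\mathbb{R}^{n\times k}$, an upper-Hessenberg $H\in\mathbb{R}^{k\times k}$, a vector $v_{k+1}\in\mathbb{R}^n$ and a scalar $\beta$ such that $$A V = V H + \beta\, v_{k+1} e_k^T$$ is a randomized Arnoldi factorization of size $k$, with $$\operatorname{span}\{U\; u\} = \operatorname{span}\{V\; v_{k+1}\}.$$ If $H$ is unreduced, the randomized Arnoldi factorization is essentially unique, that is, unique up to the signs of the sub-diagonal elements of $H$ and of the vectors $v_i$.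
   Context: The span of a matrix is the span of its columns; $e_i$ is the $i$-th canonical basis vector of $\mathbb{R}^k$; $\|\cdot\|$ is the Euclidean norm on vectors. $\epsilon$-embedding: for a subspace $\mathcal{S}\subset\mathbb{R}^n$ and $\epsilon\in[0,1)$, $\Omega\in\mathbb{R}^{d\times n}$ is an $\epsilon$-embedding for $\mathcal{S}$ if $(1-\epsilon)\|x\|^2\le\|\Omega x\|^2\le(1+\epsilon)\|x\|^2$ for all $x\in\mathcal{S}$. The matrix $\Omega$ is fixed, and is an $\epsilon$-embedding for the common space $\operatorname{span}\{U\;u\}=\operatorname{span}\{V\;v_{k+1}\}$. A matrix $M$ is sketch-orthonormal if $(\Omega M)^T(\Omega M)=I$. Krylov subspace: $\mathcal{K}_j(A,v)=\operatorname{span}\{v,Av,\dots,A^{j-1}v\}$; every Krylov subspace $\mathcal{K}_j$ considered is assumed to have dimension exactly $j$. Krylov decomposition of order $k$: a relation $AU=UB+u b^T$ where $B\in\mathbb{R}^{k\times k}$ has rank $k$ and the $k+1$ columns of $(U\;u)$ are linearly independent. Randomized Arnoldi factorization of size $k$: a relation $AV=VH+\beta v_{k+1}e_k^T$ where $H\in\mathbb{R}^{k\times k}$ is upper-Hessenberg (unreduced if all its sub-diagonal entries are nonzero), and $(V\;v_{k+1})=(v_1,\dots,v_{k+1})$ is sketch-orthonormal and is a basis of $\mathcal{K}_{k+1}(A,v_1)$.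
   Formalization: The dimension assumption is read as: every K_j(A,v), v≠0, inside span U has dimension j. Uniqueness compares factorizations with the same span V, or assumes dim K_{k+2}(A,v_1)=k+2, since it fails when span{U u} is A-invariant. *)

(* Defs.v *)
From mathcomp Require Import all_boot all_order all_algebra.

Set Implicit Arguments.
Unset Strict Implicit.
Unset Printing Implicit Defensive.

Import Order.TTheory GRing.Theory Num.Theory.
Local Open Scope ring_scope.

(* The Krylov decompositions and Arnoldi factorizations below have size k.+1,  *)
(* so that v_1 is column ord0 and e_k is the canonical vector at ord_max; the  *)
(* matrix (U u) is row_mx U u.                                                 *)

Section RandomizedArnoldi.

Variable R : rcfType.

Definition enorm n (x : 'cV[R]_n) : R := Num.sqrt (\sum_i x i 0 ^+ 2).

Definition columns n m (M : 'M[R]_(n, m)) : m.-tuple 'cV[R]_n :=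
  [tuple col j M | j < m].

Definition colspan n m (M : 'M[R]_(n, m)) : {vspace 'cV[R]_n} :=
  <<columns M>>%VS.

Definition evec m (i : 'I_m) : 'cV[R]_m := delta_mx i 0.

Definition eps_embedding d n (Omega : 'M[R]_(d, n)) (eps : R)
    (S : {vspace 'cV[R]_n}) : Prop :=
  forall x, x \in S ->
    (1 - eps) * enorm x ^+ 2 <= enorm (Omega *m x) ^+ 2
                             <= (1 + eps) * enorm x ^+ 2.

Definition sketch_orthonormal d n m (Omega : 'M[R]_(d, n))
    (M : 'M[R]_(n, m)) : Prop :=
  (Omega *m M)^T *m (Omega *m M) = 1%:M.

Definition krylov n (A : 'M[R]_n) (v : 'cV[R]_n) (j : nat) :
    {vspace 'cV[R]_n} :=
  <<[tuple A ^+ i *m v | i < j]>>%VS.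

(* No Krylov subspace inside W breaks down: each K_j(A, v) has dimension j.    *)
Definition krylov_regular n (A : 'M[R]_n) (W : {vspace 'cV[R]_n}) : Prop :=
  forall (v : 'cV[R]_n) (j : nat),
    v != 0 -> (krylov A v j <= W)%VS -> \dim (krylov A v j) = j.

Definition krylov_decomposition n k (A : 'M[R]_n) (U : 'M[R]_(n, k))
    (B : 'M[R]_k) (u : 'cV[R]_n) (b : 'cV[R]_k) : Prop :=
  [/\ A *m U = U *m B + u *m b^T,
      \rank B = k
    & free (columns (row_mx U u))].

Definition upper_hessenberg m (H : 'M[R]_m) : Prop :=
  forall i j : 'I_m, (j.+1 < i)%N -> H i j = 0.

Definition unreduced m (H : 'M[R]_m) : Prop :=
  forall i j : 'I_m, i = j.+1 :> nat -> H i j != 0.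

Definition randomized_arnoldi d n k (Omega : 'M[R]_(d, n)) (A : 'M[R]_n)
    (V : 'M[R]_(n, k.+1)) (H : 'M[R]_k.+1) (v : 'cV[R]_n) (beta : R) : Prop :=
  [/\ A *m V = V *m H + beta *: (v *m (evec ord_max)^T),
      upper_hessenberg H,
      sketch_orthonormal Omega (row_mx V v)
    & basis_of (krylov A (col ord0 V) k.+2) (columns (row_mx V v))].

(* Changing the signs of v_1, ..., v_k by the diagonal sign matrix D and that  *)
(* of v_{k+1} by t replaces H by D H D and beta by t * D_kk * beta.            *)
Definition same_up_to_signs n k
    (V : 'M[R]_(n, k.+1)) (H : 'M[R]_k.+1) (v : 'cV[R]_n) (beta : R)
    (V' : 'M[R]_(n, k.+1)) (H' : 'M[R]_k.+1) (v' : 'cV[R]_n) (beta' : R) :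
    Prop :=
  exists (s : 'I_k.+1 -> bool) (t : bool),
    [/\ forall j, col j V' = (-1) ^+ s j *: col j V,
        v' = (-1) ^+ t *: v,
        forall i j, H' i j = (-1) ^+ s i * H i j * (-1) ^+ s j
      & beta' = (-1) ^+ t * beta * (-1) ^+ s ord_max].

End RandomizedArnoldi.

(* Main.v *)
(* Writing A U = U B + u b^T, the k conditions b^T B^i x = 0 (i < k) on x in
   R^(k+1) have a nonzero solution, and then v = U x satisfies A^i v = U B^i x
   for i <= k.  Regularity forces K_(k+2)(A, v) = span (U u), and the sketched
   QR factorization of its Krylov basis is an Arnoldi basis.  Conversely an
   Arnoldi basis is a Krylov matrix times a triangular matrix, so two of them
   whose first vectors are proportional differ by a matrix that is triangular
   and orthogonal, i.e. a diagonal matrix of signs. *)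
Require Import Defs.
From mathcomp Require Import all_boot all_order all_algebra.

Set Implicit Arguments.
Unset Strict Implicit.
Unset Printing Implicit Defensive.

Import Order.TTheory GRing.Theory Num.Theory.
Local Open Scope ring_scope.

(** * Triangular matrices; [is_trig_mx] means lower triangular, so upper triangular factors appear
    through their transposes *)

Lemma trig_mx_inv (F : fieldType) m (T S : 'M[F]_m) :
  is_trig_mx T -> T *m S = 1%:M -> is_trig_mx S.
Proof.
move=> /is_trig_mxP Ttrig TS1.
have Tdiag i : T i i != 0.
  have: T \in unitmx by have [] := mulmx1_unit TS1.
  rewrite unitmxE (det_trig (introT is_trig_mxP Ttrig)) unitfE.
  by move=> /prodf_neq0/(_ i isT).
(* Forward substitution: by strong induction on the row [i], entry [(i, j)] of [T *m S] reduces to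
   [T i i * S i j]. *)
apply/is_trig_mxP => i j; have [p] := ubnP (i : nat).
elim: p => // p IHp in i *; rewrite ltnS => le_ip lt_ij.
move/matrixP/(_ i j): TS1; rewrite !mxE (bigD1 i) //= big1 => [|l neq_li].
  have -> : (i == j) = false by apply/negbTE; rewrite neq_ltn lt_ij.
  by rewrite addr0 => /eqP; rewrite mulf_eq0 (negPf (Tdiag i)) => /eqP.
have [lt_li|lt_il|/val_inj eq_li] := ltngtP l i.
- by rewrite (IHp l) ?mulr0 ?(leq_trans lt_li) // ltnW.
- by rewrite Ttrig ?mul0r.
- by rewrite eq_li eqxx in neq_li.
Qed.

Lemma trig_mxM (F : fieldType) m (T S : 'M[F]_m) :
  is_trig_mx T -> is_trig_mx S -> is_trig_mx (T *m S).
Proof.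
move=> /is_trig_mxP Ttrig /is_trig_mxP Strig.
apply/is_trig_mxP => i j lt_ij; rewrite mxE big1 // => l _.
have [lt_il|le_li] := ltnP i l; first by rewrite Ttrig ?mul0r.
by rewrite Strig ?mulr0 // (leq_ltn_trans le_li).
Qed.

(** * Euclidean norm and QR factorization *)

Section Euclidean.
Variable R : rcfType.

Lemma enorm_sqr n (x : 'cV[R]_n) : x^T *m x = (enorm x ^+ 2)%:M.
Proof.
rewrite /enorm sqr_sqrtr; last by apply: sumr_ge0 => i _; exact: sqr_ge0.
by apply/matrixP => i j; rewrite !ord1 !mxE eqxx mulr1n;
  apply: eq_bigr => l _; rewrite mxE expr2.
Qed.

Lemma enorm_eq0 n (x : 'cV[R]_n) : enorm x = 0 -> x = 0.
Proof.
rewrite /enorm => /eqP; rewrite sqrtr_eq0 => le0.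
have: \sum_i x i 0 ^+ 2 == 0.
  by rewrite eq_le le0 sumr_ge0 // => i _; exact: sqr_ge0.
rewrite psumr_eq0 => [|i _]; last exact: sqr_ge0.
move=> /allP x0; apply/colP => i; rewrite mxE.
by have := x0 i (mem_index_enum i); rewrite /= sqrf_eq0 => /eqP.
Qed.

(** Gram-Schmidt by induction on the columns: normalize the first, project it out of the others,
    orthonormalize what is left. [T] is the inverse of the usual triangular factor. *)
Lemma qr_exists d m (X : 'M[R]_(d, m)) :
    (forall c : 'cV_m, X *m c = 0 -> c = 0) ->
  exists2 T : 'M[R]_m,
    is_trig_mx T^T & (X *m T)^T *m (X *m T) = 1%:M.
Proof.
elim: m X => [|m IHm].
  move=> X _; exists 0; first by rewrite trmx0 mx0_is_trig.
  by apply/matrixP => -[].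
rewrite -[m.+1]add1n => X Xinj.
pose x := lsubmx X; pose X1 := rsubmx X.
have defX : X = row_mx x X1 by rewrite hsubmxK.
have injxX (a : 'cV_1) (c : 'cV_m) :
    x *m a + X1 *m c = 0 -> a = 0 /\ c = 0.
  move=> ac0; have /Xinj: X *m col_mx a c = 0.
    by rewrite defX mul_row_col.
  by move/eqP; rewrite col_mx_eq0 => /andP[/eqP-> /eqP->].
have x_neq0 : enorm x != 0.
  apply/eqP => /enorm_eq0 x0.
  have [/matrixP/(_ 0 0)/eqP] : (1 : 'M[R]_1) = 0 /\ (0 : 'cV[R]_m) = 0.
    by apply: injxX; rewrite x0 mul0mx mulmx0 addr0.
  by rewrite !mxE eqxx oner_eq0.
pose a := (enorm x)^-1; pose q := a *: x.
have xaE p (z : 'M_(_, p)) : x *m (a *: z) = q *m z.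
  by rewrite /q -scalemxAl -scalemxAr.
have qq : q^T *m q = 1%:M.
  rewrite [q^T]linearZ /= /q -scalemxAl -scalemxAr enorm_sqr scalerA.
  by rewrite scale_scalar_mx -expr2 exprVn mulVf // expf_neq0.
pose Y := X1 - q *m (q^T *m X1).
have qY : q^T *m Y = 0 by rewrite mulmxBr [q^T *m (q *m _)]mulmxA qq mul1mx subrr.
(* A kernel vector [c] of [Y] extends to one of [X] by the leading entry [- a q^T X1 c], so [Y]
   inherits injectivity. *)
have [c Yc0|T1 T1trig YT1] := IHm Y.
  suff [] : - (a *: (q^T *m X1 *m c)) = 0 /\ c = 0 by [].
  by apply: injxX; rewrite -Yc0 mulmxBl addrC mulmxN xaE !mulmxA.
(* The upper right block removes from [X1 *m T1] its component along [q]; the factor [a] turns [x]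
   into [q]. *)
pose T : 'M_(1 + m) := block_mx a%:M (- (a *: (q^T *m X1 *m T1))) 0 T1.
have XT : X *m T = row_mx q (Y *m T1).
  rewrite defX mul_row_block mulmx0 addr0 mul_mx_scalar; congr row_mx.
  by rewrite mulmxBl addrC mulmxN xaE !mulmxA.
exists T.
  by rewrite tr_block_mx is_trig_block_mx // trmx0 eqxx mx11_is_trig.
rewrite XT tr_row_mx mul_col_row qq YT1 trmx_mul.
rewrite -mulmxA -[Y^T *m q]trmxK trmx_mul trmxK qY trmx0 mulmx0.
by rewrite mulmxA qY mul0mx [RHS]scalar_mx_block.
Qed.

End Euclidean.

(** * Column spans in terms of matrix products *)

Section Spans.
Variable R : rcfType.

Lemma mulmx_sum_columns n m (M : 'M[R]_(n, m)) (c : 'cV_m) :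
  M *m c = \sum_i c i 0 *: (columns M)`_i.
Proof.
apply/colP => i; rewrite mxE summxE; apply: eq_bigr => j _.
by rewrite nth_mktuple !mxE mulrC.
Qed.

Lemma memv_colspan n m (M : 'M[R]_(n, m)) (x : 'cV_n) :
  reflect (exists c : 'cV_m, x = M *m c) (x \in colspan M).
Proof.
apply: (iffP idP) => [/coord_span->|[c ->]].
  exists (\col_i coord (columns M) i x).
  by rewrite mulmx_sum_columns; apply: eq_bigr => i _; rewrite mxE.
rewrite mulmx_sum_columns; apply: memv_suml => i _.
by rewrite memvZ ?memv_span ?mem_nth ?size_tuple.
Qed.

Lemma free_columnsP n m (M : 'M[R]_(n, m)) :
  reflect (forall c : 'cV_m, M *m c = 0 -> c = 0) (free (columns M)).
Proof.
apply: (iffP freeP) => [fM c|inj f f0 i].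
  rewrite mulmx_sum_columns => /fM c0.
  by apply/colP => i; rewrite c0 mxE.
have := inj (\col_i f i); rewrite mulmx_sum_columns.
under eq_bigr do rewrite mxE.
by move=> /(_ f0)/colP/(_ i); rewrite !mxE.
Qed.

Lemma colspan_subP n m p (M : 'M[R]_(n, m)) (N : 'M[R]_(n, p)) :
  reflect (exists X, N = M *m X) (colspan N <= colspan M)%VS.
Proof.
apply: (iffP subvP) => [subNM|[X ->] x /memv_colspan[c ->]]; last first.
  by apply/memv_colspan; exists (X *m c); rewrite mulmxA.
have /fin_all_exists[f fE] (j : 'I_p) : exists c : 'cV_m, col j N = M *m c.
  apply/memv_colspan/subNM/memv_colspan.
  by exists (delta_mx j 0); rewrite colE.
exists (\matrix_(i, j) f j i 0); apply/matrixP => i j.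
have /colP/(_ i) := fE j; rewrite !mxE => ->.
by apply: eq_bigr => l _; rewrite mxE.
Qed.

(** * Krylov subspaces and Krylov matrices *)

Lemma mulmxXS n (A : 'M[R]_n) i (v : 'cV_n) :
  A ^+ i.+1 *m v = A *m (A ^+ i *m v).
Proof. by rewrite mulmxA exprS. Qed.

Lemma krylovS n (A : 'M[R]_n) v j :
  krylov A v j.+1 = (krylov A v j + <[A ^+ j *m v]>)%VS.
Proof.
have kryE p : krylov A v p = <<[seq A ^+ i *m v | i <- iota 0 p]>>%VS.
  by rewrite /krylov /= -val_enum_ord -map_comp.
by rewrite !kryE -[j.+1]addn1 iotaD map_cat span_cat /= span_seq1.
Qed.

Lemma krylov_pow n (A : 'M[R]_n) v j i :
  (i < j)%N -> A ^+ i *m v \in krylov A v j.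
Proof.
move=> lt_ij; apply/memv_span/mapP; exists (Ordinal lt_ij) => //.
exact: mem_enum.
Qed.

Lemma krylov_subP n (A : 'M[R]_n) v j (W : {vspace 'cV[R]_n}) :
  reflect (forall i, (i < j)%N -> A ^+ i *m v \in W) (krylov A v j <= W)%VS.
Proof.
apply: (iffP idP) => [/subvP sW i lt_ij|vW].
  exact/sW/krylov_pow.
by apply/span_subvP => _ /mapP[i _ ->]; apply: vW.
Qed.

Lemma dim_krylov n (A : 'M[R]_n) v j : (\dim (krylov A v j) <= j)%N.
Proof. by rewrite (leq_trans (dim_span _)) ?size_tuple. Qed.

Lemma krylov_mulmx n (A : 'M[R]_n) v j x :
  x \in krylov A v j -> A *m x \in krylov A v j.+1.
Proof.
move=> /coord_span->; rewrite mulmx_sumr; apply: memv_suml => i _.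
rewrite -scalemxAr memvZ // (nth_map i) ?size_enum_ord // nth_ord_enum.
by rewrite -mulmxXS krylov_pow // ltnS.
Qed.

Lemma krylov_mulmxX n (A : 'M[R]_n) v j i x :
  x \in krylov A v j -> A ^+ i *m x \in krylov A v (i + j).
Proof.
elim: i => [|i IHi] xK; first by rewrite mul1mx.
by rewrite mulmxXS addSn krylov_mulmx // IHi.
Qed.

(** Each new power raises the dimension by at most one, so full dimension forces a gain at the last
    step. *)
Lemma krylov_dimS n (A : 'M[R]_n) v j :
    \dim (krylov A v j.+1) = j.+1 ->
  \dim (krylov A v j) = j /\ A ^+ j *m v \notin krylov A v j.
Proof.
move=> dimS; split.
  apply/eqP; rewrite eqn_leq dim_krylov /= -ltnS -dimS krylovS.
  rewrite (leq_trans (dimv_add_leqif _ _)) // -[leqRHS]addn1 leq_add2l dim_vline.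
  exact: leq_b1.
apply/negP => vK; have := dim_krylov A v j.
suff -> : krylov A v j = krylov A v j.+1 by rewrite dimS ltnn.
by rewrite krylovS; apply/esym/addv_idPl; rewrite -memvE.
Qed.

(* If v' = p(A) v with 0 < deg p = m < N, then A ^ (N - m) v' lies in the same
   Krylov space, but involves A ^ N v with a nonzero coefficient. *)
Lemma krylov_start_unique n (A : 'M[R]_n) v v' N :
    A ^+ N *m v \notin krylov A v N -> (0 < N)%N ->
    (krylov A v' N <= krylov A v N)%VS ->
  v' \in <[v]>%VS.
Proof.
move=> vN N_gt0 /krylov_subP sub.
(* The degree bound is lowered from [N] to 1: as long as [m > 1], the coefficient [a] of the top
   power must vanish. *)
suff v'K m : (0 < m <= N)%N -> v' \in krylov A v m -> v' \in <[v]>%VS.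
  by apply: (v'K N); rewrite ?N_gt0 ?leqnn // -[v']mul1mx (sub 0).
elim: m => // -[|m] IHm /andP[_ le_mN].
  by rewrite krylovS /krylov /= enum_ord0 span_nil add0v mul1mx.
rewrite krylovS => /memv_addP[y yK [_ /vlineP[a ->] v'E]].
have [a0|a_neq0] := eqVneq a 0.
  by apply: IHm; rewrite ?v'E ?a0 ?scale0r ?addr0 //= ltnW.
case/negP: vN.
have Am : A ^+ (N - m.+1) *m (a *: (A ^+ m.+1 *m v)) = a *: (A ^+ N *m v).
  by rewrite -scalemxAr mulmxA mulmxE -exprD subnK // ltnW.
suff: a *: (A ^+ N *m v) \in krylov A v N by rewrite rpredZeq (negPf a_neq0).
rewrite -Am -[X in _ *m X](addKr y) -v'E mulmxDr mulmxN.
rewrite memvD ?memvN ?sub ?ltn_subrL //.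
by rewrite -[X in krylov _ _ X](subnK (ltnW le_mN)) krylov_mulmxX.
Qed.

Definition krylov_mx n (A : 'M[R]_n) (v : 'cV_n) j : 'M_(n, j) :=
  \matrix_(i < n, l < j) (A ^+ l *m v) i 0.

Lemma col_krylov_mx n (A : 'M[R]_n) v j (l : 'I_j) :
  col l (krylov_mx A v j) = A ^+ l *m v.
Proof. by apply/colP => i; rewrite !mxE. Qed.

Lemma columns_krylov_mx n (A : 'M[R]_n) v j :
  columns (krylov_mx A v j) = [tuple A ^+ i *m v | i < j].
Proof. by apply: eq_from_tnth => l; rewrite !tnth_mktuple col_krylov_mx. Qed.

Lemma colspan_krylov_mx n (A : 'M[R]_n) v j :
  colspan (krylov_mx A v j) = krylov A v j.
Proof. by rewrite /colspan columns_krylov_mx. Qed.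

Lemma krylov_mxZ n (A : 'M[R]_n) v j a :
  krylov_mx A (a *: v) j = a *: krylov_mx A v j.
Proof. by apply/matrixP => i l; rewrite mxE -scalemxAr !mxE. Qed.

Lemma krylovZ n (A : 'M[R]_n) v j a :
  a != 0 -> krylov A (a *: v) j = krylov A v j.
Proof.
move=> a0; rewrite -!colspan_krylov_mx krylov_mxZ; apply/eqP.
rewrite eqEsubv; apply/andP; split; apply/colspan_subP.
  by exists a%:M; rewrite mul_mx_scalar.
by exists a^-1%:M; rewrite mul_mx_scalar scalerA mulVf ?scale1r.
Qed.

End Spans.

(** * Arnoldi factorizations for a fixed sketch: existence *)

Section Arnoldi.
Variables (R : rcfType) (d n k : nat) (Omega : 'M[R]_(d, n)) (A : 'M[R]_n).

Lemma sketch_orthonormal_free m (M : 'M[R]_(n, m)) :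
  sketch_orthonormal Omega M -> free (columns M).
Proof.
move=> ortho; apply/free_columnsP => c Mc0.
by rewrite -[c]mul1mx -ortho -!mulmxA Mc0 !mulmx0.
Qed.

(** A start in span [U] whose iterates avoid [u] for k steps keeps K_(k+1) inside span [U], where
    regularity applies; one more step fills the span of [(U u)]. *)
Lemma krylov_start (U : 'M[R]_(n, k.+1)) B (u : 'cV_n) b :
    A *m U = U *m B + u *m b^T -> free (columns (row_mx U u)) ->
    krylov_regular A (colspan U) ->
  exists v, krylov A v k.+2 = colspan (row_mx U u) /\
    \dim (krylov A v k.+2) = k.+2.
Proof.
move=> AU free_Uu regular.
pose C := \matrix_(i < k, l < k.+1) (b^T *m B ^+ i) 0 l.
have [x x_neq0 Cx0] : exists2 x : 'cV_k.+1, x != 0 & C *m x = 0.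
  (* [kermx] acts on rows, hence the transposes; [C] has k rows and k+1 columns, so the kernel is
     nonzero. *)
  exists (nz_row (kermx C^T))^T.
    rewrite trmx_eq0 nz_row_eq0 -mxrank_eq0 mxrank_ker -lt0n subn_gt0.
    by rewrite ltnS rank_leq_col.
  apply: trmx_inj; rewrite trmx_mul trmxK trmx0.
  by apply/sub_kermxP/nz_row_sub.
have AUx i : (i <= k)%N -> A ^+ i *m (U *m x) = U *m (B ^+ i *m x).
  elim: i => [|i IHi] lt_ik; first by rewrite !mul1mx.
  rewrite mulmxXS IHi 1?ltnW // mulmxA AU mulmxDl -!mulmxA -mulmxXS.
  suff -> : b^T *m (B ^+ i *m x) = 0 by rewrite mulmx0 addr0.
  apply/matrixP => p q; rewrite !ord1 mulmxA.
  have /matrixP/(_ (Ordinal lt_ik) 0) := Cx0; rewrite !mxE => Cx0i.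
  by rewrite -[RHS]Cx0i; apply: eq_bigr => l _; rewrite !mxE.
have Uinj := free_columnsP _ free_Uu.
have v_neq0 : U *m x != 0.
  apply: contra_neq x_neq0 => Ux0.
  have := Uinj (col_mx x 0); rewrite mul_row_col Ux0 mulmx0 addr0.
  by move=> /(_ erefl)/eqP; rewrite col_mx_eq0 => /andP[/eqP].
have subU : (krylov A (U *m x) k.+1 <= colspan U)%VS.
  apply/krylov_subP => i lt_ik; apply/memv_colspan.
  by exists (B ^+ i *m x); apply: AUx.
have dimK := regular _ _ v_neq0 subU.
(* If K_(k+2) were equal to K_(k+1), it would lie in span [U], and regularity would give it both
   dimensions k+1 and k+2. *)
have dimK2 : \dim (krylov A (U *m x) k.+2) = k.+2.
  apply/eqP; rewrite eqn_leq dim_krylov /= -[X in (X < _)%N]dimK ltnNge.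
  have sub2 : (krylov A (U *m x) k.+1 <= krylov A (U *m x) k.+2)%VS.
    by rewrite [X in (_ <= X)%VS]krylovS addvSl.
  rewrite (geq_leqif (dimv_leqif_eq sub2)); apply/eqP => eqK.
  rewrite eqK in subU.
  by have := regular _ _ v_neq0 subU; rewrite -eqK dimK => /n_Sn.
exists (U *m x); split=> //; apply/eqP; rewrite eqEdim dimK2.
rewrite (leq_trans (dim_span _)) ?size_tuple ?addn1 // andbT.
apply/krylov_subP => -[_|i lt_ik]; apply/memv_colspan.
  by exists (col_mx x 0); rewrite mul_row_col mulmx0 addr0 mul1mx.
exists (col_mx (B *m (B ^+ i *m x)) (b^T *m (B ^+ i *m x))).
by rewrite mul_row_col mulmxXS AUx // mulmxA AU mulmxDl !mulmxA.
Qed.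

(** QR is applied to the sketched Krylov matrix [Omega *m K]; the same [T] makes [K *m T]
    sketch-orthonormal. Since [A] shifts the columns of [K], its matrix in this basis is
    Hessenberg. *)
Lemma arnoldi_exists v :
    \dim (krylov A v k.+2) = k.+2 ->
    (forall x, x \in krylov A v k.+2 -> Omega *m x = 0 -> x = 0) ->
  exists (V : 'M_(n, k.+1)) H (w : 'cV_n) beta,
    randomized_arnoldi Omega A V H w beta /\
    krylov A v k.+2 = colspan (row_mx V w).
Proof.
rewrite -[k.+2]addn1 => dimK Oinj.
pose K := krylov_mx A v (k.+1 + 1).
have Kfree : free (columns K).
  by rewrite /free columns_krylov_mx -/(krylov _ _ _) dimK size_tuple.
have Kinj (c : 'cV_(k.+1 + 1)) : Omega *m K *m c = 0 -> c = 0.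
  rewrite -mulmxA => OKc0; apply: (free_columnsP _ Kfree).
  by apply: Oinj; rewrite // -colspan_krylov_mx; apply/memv_colspan; exists c.
have [T Ttrig] := qr_exists Kinj.
rewrite -mulmxA; set M := K *m T => Mortho.
have [S TS1] : exists S, T *m S = 1%:M.
  by exists ((Omega *m M)^T *m (Omega *m K)); apply: mulmx1C;
    rewrite -!mulmxA.
have Strig : is_trig_mx S^T.
  by apply: trig_mx_inv Ttrig _; rewrite -trmx_mul (mulmx1C TS1) trmx1.
have MS : M *m S = K by rewrite -mulmxA TS1 mulmx1.
have T0 (i j : 'I_(k.+1 + 1)) : (j < i)%N -> T i j = 0.
  by move=> lt_ji; have /is_trig_mxP/(_ j i lt_ji) := Ttrig; rewrite mxE.
have S0 (i j : 'I_(k.+1 + 1)) : (j < i)%N -> S i j = 0.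
  by move=> lt_ji; have /is_trig_mxP/(_ j i lt_ji) := Strig; rewrite mxE.
(* [sh l] is the index l+1: [A] sends column [l] of [K] to column [sh l], which is [M] times column
   [sh l] of [S]. *)
pose sh (l : 'I_k.+1) := cast_ord (addnC 1 k.+1) (rshift 1 l).
pose G := colsub sh S *m ulsubmx T.
have AV : A *m lsubmx M = M *m G.
  have -> : lsubmx M = lsubmx K *m ulsubmx T.
    rewrite /M -mulmx_lsub -[in LHS](hsubmxK K) -[lsubmx T]vsubmxK.
    rewrite mul_row_col (_ : dsubmx (lsubmx T) = 0).
      rewrite mulmx0 addr0; congr (_ *m _).
      by apply/matrixP => i j; rewrite !mxE.
    by apply/matrixP => i j; rewrite !mxE T0 //= ord1 addn0.
  rewrite !mulmxA; congr (_ *m _).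
  rewrite mulmx_colsub MS; apply/matrixP => i l.
  rewrite !mxE; have /colP/(_ i) := mulmxXS A l v; rewrite !mxE => ->.
  by apply: eq_bigr => p _; rewrite mxE [K _ _]mxE.
(* Shifting the columns of the upper triangular [S] by one adds one sub-diagonal; the factor from
   [T] adds none. *)
have Ghess (i : 'I_(k.+1 + 1)) (l : 'I_k.+1) : (l.+1 < i)%N -> G i l = 0.
  move=> lt_li; rewrite mxE big1 // => p _; rewrite !mxE.
  have [lt_lp|le_pl] := ltnP l p; first by rewrite T0 ?mulr0.
  by rewrite S0 ?mul0r //= (leq_ltn_trans _ lt_li).
have spanM : colspan M = krylov A v (k.+1 + 1).
  rewrite -colspan_krylov_mx; apply/eqP; rewrite eqEsubv.
  by apply/andP; split; apply/colspan_subP; [exists T | exists S].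
(* The first column of [M] is a multiple of [v], nonzero by [T00] below, so both generate the same
   Krylov space. *)
have colM0 : col ord0 (lsubmx M) = T (lshift 1 ord0) (lshift 1 ord0) *: v.
  apply/colP => i; rewrite !mxE (bigD1 (lshift 1 ord0)) //= big1.
    by rewrite [K _ _]mxE mul1mx addr0 mulrC.
  move=> j j_neq0; rewrite T0 ?mulr0 // lt0n.
  by apply: contra_neq j_neq0 => j0; apply/val_inj.
have Mfree := sketch_orthonormal_free Mortho.
have T00 : T (lshift 1 ord0) (lshift 1 ord0) != 0.
  apply/eqP => T00; have := free_columnsP _ Mfree (delta_mx (lshift 1 ord0) 0).
  rewrite -colE (_ : col _ M = col ord0 (lsubmx M)); last first.
    by apply/colP => i; rewrite !mxE.
  rewrite colM0 T00 scale0r => /(_ erefl)/matrixP/(_ (lshift 1 ord0) 0).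
  by rewrite !mxE !eqxx => /eqP; rewrite oner_eq0.
(* By the Hessenberg shape, the bottom row of [G] vanishes except for its last entry, which serves
   as [beta]. *)
exists (lsubmx M), (usubmx G), (rsubmx M), (dsubmx G 0 ord_max).
rewrite hsubmxK spanM; split=> //; split; last 2 first.
- by rewrite hsubmxK.
- rewrite colM0 -[k.+2]addn1 krylovZ // hsubmxK -spanM.
  by rewrite /basis_of -/(colspan M) eqxx Mfree.
- rewrite AV -[in LHS](hsubmxK M) -[in LHS](vsubmxK G) mul_row_col.
  congr (_ + _); rewrite scalemxAr; congr (_ *m _).
  apply/matrixP => i l; rewrite ord1 [RHS]mxE [_^T _ _]mxE [evec _ _ _ _]mxE.
  have [->|l_neq] := eqVneq l ord_max; first by rewrite mulr1.
  rewrite mulr0 [LHS]mxE Ghess //= addn0 ltnS ltn_neqAle -ltnS ltn_ord andbT.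
  by apply: contra_neq l_neq => l_eq; apply/val_inj.
by move=> i j lt_ji; rewrite mxE Ghess.
Qed.

(** * Krylov structure of a given Arnoldi factorization *)

Section Factorization.
Variables (V : 'M[R]_(n, k.+1)) (H : 'M[R]_k.+1) (w : 'cV[R]_n) (beta : R).
Hypothesis fact : randomized_arnoldi Omega A V H w beta.
Let M := row_mx V w.
(** Stacking the residual row under [H] turns the factorization into the single product
    [A V = M G]. *)
Let G : 'M_(k.+1 + 1, k.+1) := col_mx H (beta *: (evec R ord_max)^T).

Lemma arnoldi_row_mx : A *m V = M *m G.
Proof. by have [-> _ _ _] := fact; rewrite mul_row_col -scalemxAr. Qed.

(** Sketch-orthonormality recovers [H] and [beta] from the basis, so two factorizations can be
    compared through their bases alone. *)
Lemma arnoldi_coords : G = (Omega *m M)^T *m (Omega *m (A *m V)).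
Proof.
have [_ _ ortho _] := fact.
by rewrite arnoldi_row_mx [Omega *m (M *m G)]mulmxA mulmxA ortho mul1mx.
Qed.

Lemma arnoldi_hessenberg (i : 'I_(k.+1 + 1)) (j : 'I_k.+1) : (j.+1 < i)%N -> G i j = 0.
Proof.
have [_ hess _ _] := fact.
rewrite mxE; case: (splitP i) => [p ->|p ->] lt_ji; first exact: hess.
rewrite !mxE; have [j_max|_] := eqVneq j ord_max; last by rewrite mulr0.
by move: lt_ji; rewrite j_max ord1 addn0 ltnn.
Qed.

Lemma arnoldi_krylov :
  colspan M = krylov A (col ord0 V) k.+2 /\
  \dim (krylov A (col ord0 V) k.+2) = k.+2.
Proof.
have [_ _ _ basisM] := fact; split; first exact: span_basis.
by rewrite (size_basis basisM) addn1.
Qed.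

(** By the Hessenberg shape, each application of [A] reaches at most one further column of [M]. *)
Lemma arnoldi_krylov_coord j :
    (j < k.+2)%N ->
  exists2 r : 'cV_(k.+1 + 1), A ^+ j *m col ord0 V = M *m r &
    forall i : 'I_(k.+1 + 1), (j < i)%N -> r i 0 = 0.
Proof.
elim: j => [_|j IHj lt_jk].
  exists (delta_mx (lshift 1 ord0) 0) => [|i]; last first.
    by rewrite mxE andbT; case: eqP => // ->.
  by rewrite mul1mx -colE; apply/colP => i; rewrite [LHS]mxE [RHS]mxE row_mxEl.
have [|r defr r0] := IHj; first exact: ltnW.
(* As [j < k.+1], the last coordinate of [r] is zero: only [V] is involved and [A V = M G]
   applies. *)
exists (G *m usubmx r).
  rewrite mulmxXS defr mulmxA.
  rewrite [M *m (G *m _)]mulmxA -arnoldi_row_mx -[r in LHS]vsubmxK.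
  rewrite -mulmxA mul_row_col (_ : dsubmx r = 0) ?mulmx0 ?addr0 ?mulmxA //.
  by apply/matrixP => p q; rewrite !ord1 !mxE r0 //= addn0.
move=> i lt_ji; rewrite mxE big1 // => l _; rewrite [usubmx r l 0]mxE.
have [lt_jl|le_lj] := ltnP j l; first by rewrite r0 ?mulr0.
by rewrite arnoldi_hessenberg ?mul0r // (leq_ltn_trans _ lt_ji).
Qed.

(** The first k+1 Krylov vectors have no component on [w]; comparing dimensions does the rest. *)
Lemma arnoldi_colspan : colspan V = krylov A (col ord0 V) k.+1.
Proof.
apply/esym/eqP; have [_ /krylov_dimS[dimK _]] := arnoldi_krylov.
rewrite eqEdim dimK (leq_trans (dim_span _)) ?size_tuple // andbT.
apply/krylov_subP => j lt_jk.
have [|r -> r0] := @arnoldi_krylov_coord j; first exact: ltnW.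
apply/memv_colspan; exists (usubmx r); rewrite -[r in LHS]vsubmxK mul_row_col.
rewrite (_ : dsubmx r = 0) ?mulmx0 ?addr0 //.
by apply/matrixP => p q; rewrite !ord1 !mxE r0 //= addn0.
Qed.

(** The coordinates of Krylov vector [j] stop at row [j], whence triangularity; [T] is invertible
    because both matrices span the same space. *)
Lemma arnoldi_krylov_mx :
  exists2 T : 'M_(k.+1 + 1), is_trig_mx T^T /\ T \in unitmx &
    krylov_mx A (col ord0 V) (k.+1 + 1) = M *m T.
Proof.
set K := krylov_mx _ _ _; have [_ _ ortho _] := fact.
have [spanM _] := arnoldi_krylov; rewrite -[k.+2]addn1 in spanM.
rewrite -colspan_krylov_mx in spanM.
have [T KE] : exists T, K = M *m T.
  by apply/colspan_subP; rewrite spanM.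
have [S ME] : exists S, M = K *m S.
  by apply/colspan_subP; rewrite spanM.
have TE : T = (Omega *m M)^T *m (Omega *m K).
  by rewrite KE [Omega *m (M *m T)]mulmxA mulmxA ortho mul1mx.
exists T => //; split; last first.
  have /mulmx1_unit[] // : T *m S = 1%:M.
  by rewrite TE -!mulmxA -ME.
apply/is_trig_mxP => j i lt_ji; rewrite mxE.
have [|r defr r0] := @arnoldi_krylov_coord j.
  by have := ltn_ord j; rewrite [X in (_ < X)%N]addn1.
have /colP/(_ i) : col j T = r.
  rewrite colE TE -!mulmxA -colE col_krylov_mx defr.
  by rewrite [Omega *m (M *m r)]mulmxA mulmxA ortho mul1mx.
by rewrite mxE r0.
Qed.

End Factorization.

(** * Essential uniqueness *)

Lemma arnoldi_signs V H w beta V' H' w' beta' (D : 'rV[R]_(k.+1 + 1)) :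
    randomized_arnoldi Omega A V H w beta ->
    randomized_arnoldi Omega A V' H' w' beta' ->
    row_mx V' w' = row_mx V w *m diag_mx D ->
    (forall i, D 0 i ^+ 2 = 1) ->
  same_up_to_signs V H w beta V' H' w' beta'.
Proof.
move=> fact fact' M'E D2.
pose s i := D 0 i == -1.
have sE i : D 0 i = (-1) ^+ s i.
  have /eqP := D2 i; rewrite sqrf_eq1 /s.
  by case: (D 0 i =P -1) => [-> //|_]; rewrite orbF => /eqP.
have M'ij p j : row_mx V' w' p j = row_mx V w p j * (-1) ^+ s j.
  by rewrite M'E mul_mx_diag mxE sE.
have V'E : V' = V *m diag_mx (lsubmx D).
  apply/matrixP => i j; rewrite mul_mx_diag !mxE sE.
  by have := M'ij i (lshift 1 j); rewrite !row_mxEl.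
(* By [arnoldi_coords] the stacked matrix picks up [D] on the left and, on the right, only the signs
   belonging to [V]. *)
have : col_mx H' (beta' *: (evec R ord_max)^T) = diag_mx D *m
    col_mx H (beta *: (evec R ord_max)^T) *m diag_mx (lsubmx D).
  rewrite (arnoldi_coords fact') (arnoldi_coords fact) M'E V'E.
  by rewrite !trmx_mul tr_diag_mx !mulmxA.
rewrite mul_mx_diag mul_diag_mx => /matrixP G'E.
exists (s \o lshift 1), (s (rshift k.+1 0)); split=> [j||i j|].
- apply/colP => i; rewrite !mxE mulrC.
  by have := M'ij i (lshift 1 j); rewrite !row_mxEl.
- apply/colP => i; rewrite !mxE mulrC.
  by have := M'ij i (rshift k.+1 0); rewrite !row_mxEr.
- have := G'E (lshift 1 i) j.
  by rewrite col_mxEu => ->; rewrite 2!mxE col_mxEu [lsubmx _ _ _]mxE !sE.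
have := G'E (rshift k.+1 0) ord_max.
rewrite col_mxEd [RHS]mxE [X in _ = X * _]mxE col_mxEd [lsubmx _ _ _]mxE !sE.
by rewrite !mxE !eqxx !mulr1 => ->.
Qed.

(** Proportional starts give proportional Krylov matrices, so the bases differ by a quotient [P] of
    triangular factors. Orthogonality makes [P^T] the inverse of [P], so [P] is triangular both
    ways, hence diagonal. *)
Lemma arnoldi_unique (V V' : 'M_(n, k.+1)) H H' w w' beta beta' :
    randomized_arnoldi Omega A V H w beta ->
    randomized_arnoldi Omega A V' H' w' beta' ->
    col ord0 V' \in <[col ord0 V]>%VS ->
  same_up_to_signs V H w beta V' H' w' beta'.
Proof.
move=> fact fact' /vlineP[c v'E].
have [T [Ttrig Tunit] KE] := arnoldi_krylov_mx fact.
have [T' [T'trig T'unit]] := arnoldi_krylov_mx fact'.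
rewrite v'E krylov_mxZ KE => K'E.
have [_ _ ortho _] := fact; have [_ _ ortho' _] := fact'.
pose P := c *: (T *m invmx T').
have M'E : row_mx V' w' = row_mx V w *m P.
  by rewrite -scalemxAr mulmxA scalemxAl K'E mulmxK.
have PP : P^T *m P = 1%:M.
  rewrite -ortho' M'E [Omega *m _]mulmxA [(_ *m P)^T]trmx_mul mulmxA.
  by rewrite -[P^T *m _ *m _]mulmxA ortho mulmx1.
have Ptrig : is_trig_mx P^T.
  have : is_trig_mx ((invmx T')^T *m T^T).
    apply: trig_mxM Ttrig; apply: trig_mx_inv T'trig _.
    by rewrite -trmx_mul mulVmx ?trmx1.
  rewrite -trmx_mul => /is_trig_mxP Ptrig.
  by apply/is_trig_mxP => i j /Ptrig; rewrite !mxE => ->; rewrite mulr0.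
have /diag_mxP[D PE] : is_diag_mx P.
  by rewrite is_diag_mxEtrig Ptrig (trig_mx_inv Ptrig PP).
rewrite PE in M'E PP.
apply: (arnoldi_signs fact fact' M'E) => i.
have /matrixP/(_ i i) := PP; rewrite tr_diag_mx mul_diag_mx !mxE eqxx.
by rewrite mulr1n -expr2.
Qed.

End Arnoldi.

Theorem theorem2p2 (R : rcfType) (d n k : nat)
    (Omega : 'M[R]_(d, n)) (eps : R)
    (A : 'M[R]_n) (U : 'M[R]_(n, k.+1)) (B : 'M[R]_k.+1)
    (u : 'cV[R]_n) (b : 'cV[R]_k.+1)
    (heps : 0 <= eps < 1)
    (hdec : krylov_decomposition A U B u b)
    (hemb : eps_embedding Omega eps (colspan (row_mx U u)))
    (hreg : krylov_regular A (colspan U)) :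
  (exists (V : 'M[R]_(n, k.+1)) (H : 'M[R]_k.+1) (v : 'cV[R]_n) (beta : R),
     randomized_arnoldi Omega A V H v beta /\
     colspan (row_mx U u) = colspan (row_mx V v)) /\
  (forall (V : 'M[R]_(n, k.+1)) (H : 'M[R]_k.+1) (v : 'cV[R]_n) (beta : R)
          (V' : 'M[R]_(n, k.+1)) (H' : 'M[R]_k.+1) (v' : 'cV[R]_n) (beta' : R),
     randomized_arnoldi Omega A V H v beta ->
     colspan (row_mx U u) = colspan (row_mx V v) ->
     unreduced H ->
     randomized_arnoldi Omega A V' H' v' beta' ->
     colspan (row_mx U u) = colspan (row_mx V' v') ->
     colspan V' = colspan V \/ \dim (krylov A (col ord0 V) k.+3) = k.+3 ->
     same_up_to_signs V H v beta V' H' v' beta').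
Proof.
have [AU _ Uu_free] := hdec.
split=> [|V H w beta V' H' w' beta' fact spanV _ fact' spanV' hspan].
  have [v [spanK dimK]] := krylov_start AU Uu_free hreg.
  rewrite -spanK; apply: arnoldi_exists => // x.
  rewrite spanK => xS Ox0.
  (* The lower embedding bound with [eps < 1] makes [Omega] injective on the span. *)
  have /andP[+ _] := hemb x xS.
  case/andP: heps => _ eps_lt1.
  rewrite Ox0 [enorm 0]/enorm big1 => [|i _]; last by rewrite mxE expr0n.
  rewrite sqrtr0 expr0n pmulr_rle0 ?subr_gt0 // => x_le0.
  by apply: enorm_eq0; apply/eqP; rewrite -sqrf_eq0 eq_le x_le0 sqr_ge0.
have [spanK dimK] := arnoldi_krylov fact.
have [spanK' dimK'] := arnoldi_krylov fact'.
apply: (arnoldi_unique fact fact').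
(* The first vectors are proportional by [krylov_start_unique]: with [N] = k+2 if K_(k+3) has full
   dimension, with [N] = k+1 if [V] and [V'] have the same span. *)
case: hspan => [eqV|/krylov_dimS[_ notinK]]; last first.
  by apply: krylov_start_unique notinK _ _; rewrite // -spanK -spanK' -spanV -spanV'.
have [_ notinK] := krylov_dimS dimK.
apply: krylov_start_unique notinK _ _ => //.
by rewrite -(arnoldi_colspan fact) -(arnoldi_colspan fact') eqV.
Qed.
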